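(* There exists an absolute constant $c_2>0$ such that the following holds. Let $r=r(n)>0$ satisfy $r^5 > c_2 \frac{\log n}{n}$. Then asymptotically almost surely (i.e., with probability tending to $1$ as $n\to\infty$) the random geometric graph $\mathcal{G}_2(n,r)$ has cop number $c(\mathcal{G}_2(n,r))=1$.
   Context: The game of Cops and Robbers is played on a finite simple undirected graph $G$ by $k\ge 1$ cops and one robber. The cops first occupy any $k$ vertices (several cops may share a vertex); then the robber chooses a vertex; then the cops and the robber move in alternate rounds, where in a move each player either stays at its current vertex or moves along an edge to an adjacent vertex. Both sides always know all current positions. The cops win if at some point a cop occupies the same vertex as the robber; otherwise the robber wins. The cop number $c(G)$ is the minimum $k$ such that $k$ cops have a winning strategy on $G$. The random geometric graph $\mathcal{G}_d(n,r)$ has vertex set $\{1,\dots,n\}$; the $n$ vertices are assigned points chosen independently and uniformly at random from $[0,1]^d$, and two vertices are adjacent if and only if the Euclidean distance between their points is at most $r$. Here $r=r(n)$ may depend on $n$, and asymptotics are as $n\to\infty$. *)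

(* Defs.v *)
From HB Require Import structures.
From mathcomp Require Import all_boot all_order all_algebra.
From mathcomp Require Import all_classical all_reals all_analysis.
Set Implicit Arguments. Unset Strict Implicit. Unset Printing Implicit Defensive.
Import Order.TTheory GRing.Theory Num.Theory.
Import numFieldNormedType.Exports.
Local Open Scope classical_set_scope.
Local Open Scope ring_scope.

Definition game_step (V : finType) (adj : rel V) (x y : V) : Prop :=
  x = y \/ adj x y.

(* [cops_force adj k b c v]: in the position where the k cops are at
   c : 'I_k -> V, the robber is at v, and it is the cops' turn (b = true)
   or the robber's turn (b = false), the cops can force capture.
   (Least fixed point = winning region of the cops in this finite
   reachability game, i.e. existence of a winning strategy.) *)
Inductive cops_force (V : finType) (adj : rel V) (k : nat) :
    bool -> ('I_k -> V) -> V -> Prop :=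
| cf_capture (b : bool) (c : 'I_k -> V) (v : V) :
    (exists i, c i = v) -> cops_force adj b c v
| cf_cops (c : 'I_k -> V) (v : V) (c' : 'I_k -> V) :
    (forall i, game_step adj (c i) (c' i)) ->
    cops_force adj false c' v -> cops_force adj true c v
| cf_robber (c : 'I_k -> V) (v : V) :
    (forall v', game_step adj v v' -> cops_force adj true c v') ->
    cops_force adj false c v.

Definition cops_win (V : finType) (adj : rel V) (k : nat) : Prop :=
  exists c : 'I_k -> V, forall v : V, cops_force adj true c v.

Definition cop_number_is (V : finType) (adj : rel V) (m : nat) : Prop :=
  (1 <= m)%N /\ cops_win adj m /\
  forall j : nat, (1 <= j)%N -> (j < m)%N -> ~ cops_win adj j.

Definition rgg_adj (R : realType) (n : nat) (x y : 'I_n -> R) (r : R) :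
    rel 'I_n :=
  fun i j => (i != j) && ((x i - x j) ^+ 2 + (y i - y j) ^+ 2 <= r ^+ 2).

Definition iid_uniform_square (R : realType) (d : measure_display)
    (T : measurableType d) (P : probability T R) (n : nat)
    (X Y : 'I_n -> T -> R) : Prop :=
  (forall i, measurable_fun setT (X i)) /\
  (forall i, measurable_fun setT (Y i)) /\
  forall A B : 'I_n -> set R,
    (forall i, measurable (A i)) -> (forall i, measurable (B i)) ->
    P (\bigcap_(i in [set: 'I_n]) (X i @^-1` A i `&` Y i @^-1` B i)) =
    (\prod_(i < n) (lebesgue_measure (A i `&` `[0%R, 1%R]) *
                    lebesgue_measure (B i `&` `[0%R, 1%R])))%E.

(* Main.v *)
(** A vertex [p] at distance [rho] from the centre of the square is dominated,
    among the vertices not farther from the centre than itself, by every point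
    of the lens of points [q] with [B(p, r)] inside [B(q, r)] up to the disc of
    radius [rho]. This lens has length of order [r^2] towards the centre and
    width of order [r^3], hence area of order [r^5 > c log n / n], so that all
    lenses contain a vertex with probability tending to 1. Deleting the vertices
    from the farthest to the nearest then dismantles the graph down to a clique
    around the centre, and one cop wins. To avoid conditioning on the position
    of [p], the square is cut into a grid of mesh of order [r^3], the lens is
    replaced by a chain of about [1/r] cells that depends only on the cell of
    [p], and the union bound is taken over the cells. *)

Require Import Defs.
From HB Require Import structures.
From mathcomp Require Import all_boot all_order all_algebra.
From mathcomp Require Import all_classical all_reals all_analysis.
From mathcomp Require Import ring lra.
From mathcomp Require Import measurable_realfun.
Set Implicit Arguments. Unset Strict Implicit. Unset Printing Implicit Defensive.
Import Order.TTheory GRing.Theory Num.Theory.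
Import numFieldNormedType.Exports.
Local Open Scope classical_set_scope.
Local Open Scope ring_scope.

(** * Dismantling *)

Lemma game_step_sym (V : finType) (adj : rel V) (x y : V) :
  symmetric adj -> game_step adj x y -> game_step adj y x.
Proof. by move=> sa [->|xy]; [left | right; rewrite sa]. Qed.

(* The cop stands on the image [phi v] of the robber in the set [A] of vertices
   that are not yet deleted; deleting one more dominated vertex from [A] costs
   the cop one extra round, and at the end [A] is a clique. *)
Lemma cops_win_retract (d : Order.disp_t) (D : orderType d) (V : finType)
    (adj : rel V) (h : V -> D) (h0 : D) (A : {set V}) (phi : V -> V) (v0 : V) :
  symmetric adj ->
  (forall x y, (h x <= h0)%O -> (h y <= h0)%O -> game_step adj x y) ->
  (forall x, (h0 < h x)%O -> exists2 u, (h u < h x)%O &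
     forall y, (h y <= h x)%O -> game_step adj x y -> game_step adj u y) ->
  (forall a b, a \in A -> b \notin A -> (h a <= h b)%O) ->
  (forall v, phi v \in A) ->
  (forall v w, game_step adj v w -> game_step adj (phi v) (phi w)) ->
  (forall v, cops_force adj false (fun _ : 'I_1 => phi v) v) ->
  cops_win adj 1.
Proof.
move=> sa clique dom.
(* Induction on a bound for the size of [A]; [phi] must vary, since each deletion composes it with a
   retraction. *)
move: {2}(#|A|) (leqnn #|A|) phi => m.
elim: m A => [|m IHm] A.
  by rewrite leqn0 => /eqP/cards0_eq-> phi _ /(_ v0); rewrite inE.
move=> leA phi hA phiA hom win.
have [/existsP[x0 /andP[x0A hx0]]|noA] := boolP [exists x in A, (h0 < h x)%O];
    last first.
  (* Nothing in [A] lies beyond [h0], so [A] is a clique and the cop, started at [phi v0], reaches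
     [phi v] in one move. *)
  have hA0 x : x \in A -> (h x <= h0)%O.
    by move=> xA; rewrite leNgt; apply: contra noA => hx; apply/existsP; exists x; rewrite xA.
  exists (fun _ => phi v0) => v.
  by apply: (@cf_cops _ _ _ _ _ (fun _ => phi v)) => // _; apply: clique; exact: hA0.
have Px0 : (x0 \in A) && (h0 < h x0)%O by rewrite x0A.
case: (@Order.TotalTheory.arg_maxP _ _ _ x0 (fun x => (x \in A) && (h0 < h x)%O) h Px0).
move=> x /andP[xA hx] xmax.
have Ax y : y \in A -> (h y <= h x)%O.
  move=> yA; have [hy|hy] := leP (h y) h0; first exact: le_trans hy (ltW hx).
  by apply: xmax; rewrite yA.
have [u ux udom] := dom x hx.
(* Deleted vertices are at least as far as [x], and [u] is strictly nearer. *)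
have uA : u \in A.
  by apply/negPn/negP => /(hA _ _ xA); rewrite leNgt ux.
have nux : u != x by apply: contraTneq ux => ->; rewrite ltxx.
pose ret y := if y == x then u else y.
have retA y : y \in A -> ret y \in A by rewrite /ret; case: ifP.
have retN y z : y \in A -> z \in A -> game_step adj y z -> game_step adj (ret y) z.
  by rewrite /ret => yA zA; case: eqP => // -> /udom; apply; exact: Ax.
apply: (IHm (A :\ x) _ (ret \o phi)).
- by rewrite (cardsD1 x) xA in leA.
- move=> a b; rewrite !inE negb_and negbK => /andP[_ aA] /orP[/eqP->|]; first exact: Ax.
  exact: hA.
- move=> v; rewrite !inE retA //= andbT /ret.
  by have [_|] := eqVneq (phi v) x.
(* [retN] retracts one endpoint; symmetry of the step relation then gives the other. *)
- move=> v w /hom vw /=. have ? := retA _ (phiA v).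
  apply: (game_step_sym sa); apply: (retN) => //.
  by apply: (game_step_sym sa); exact: retN.
(* The extra round: when the robber goes to [w], the cop on [ret (phi v)] can step to [phi w], since
   [u] dominates [x]; from there [win] applies. *)
- move=> v; apply: cf_robber => w /hom vw.
  by apply: (@cf_cops _ _ _ _ _ (fun _ => phi w)) => // _; exact: retN.
Qed.

Lemma cops_win_dismantle (d : Order.disp_t) (D : orderType d) (V : finType)
    (adj : rel V) (h : V -> D) (h0 : D) (v0 : V) :
  symmetric adj ->
  (forall x y, (h x <= h0)%O -> (h y <= h0)%O -> game_step adj x y) ->
  (forall x, (h0 < h x)%O -> exists2 u, (h u < h x)%O &
     forall y, (h y <= h x)%O -> game_step adj x y -> game_step adj u y) ->
  cops_win adj 1.
Proof.
move=> sa clique dom.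
apply: (@cops_win_retract _ _ _ _ h h0 [set: V]%SET id v0 sa clique dom) => //.
- by move=> a b _; rewrite inE.
- by move=> v; apply: cf_capture; exists ord0.
Qed.

(** * Lenses in the plane *)

Lemma ler_normM_bound (R : realFieldType) (a b c d : R) :
  `|a| <= c -> `|b| <= d -> a * b <= c * d.
Proof.
by move=> ac bd; rewrite (le_trans (ler_norm _)) // normrM ler_pM.
Qed.

(* For [|z| <= r] and [|p + z| <= |p|], expand [|z + w|^2] with [w = t p + e]
   and use [2 p.z <= - |z|^2]. *)
Lemma lens_dominates (R : realFieldType) (r t e px py wx wy zx zy : R) :
  0 <= r -> 0 <= t <= 1 ->
  `|wx - t * px| <= e -> `|wy - t * py| <= e ->
  4 * e * r + 4 * e ^+ 2 + 2 * t ^+ 2 * (px ^+ 2 + py ^+ 2) <= t * r ^+ 2 ->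
  zx ^+ 2 + zy ^+ 2 <= r ^+ 2 ->
  (px + zx) ^+ 2 + (py + zy) ^+ 2 <= px ^+ 2 + py ^+ 2 ->
  (zx + wx) ^+ 2 + (zy + wy) ^+ 2 <= r ^+ 2.
Proof.
move=> r0 /andP[t0 t1]; set ex := wx - t * px; set ey := wy - t * py.
move=> hex hey hr hz hp.
have -> : wx = t * px + ex by rewrite /ex; ring.
have -> : wy = t * py + ey by rewrite /ey; ring.
have zxr : `|zx| <= r.
  by rewrite -(ler_pXn2r (ltn0Sn 1)) ?nnegrE // real_normK ?num_real //; nra.
have zyr : `|zy| <= r.
  by rewrite -(ler_pXn2r (ltn0Sn 1)) ?nnegrE // real_normK ?num_real //; nra.
have h1 := ler_normM_bound hex zxr.
have h2 := ler_normM_bound hey zyr.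
have h3 := ler_normM_bound hex hex.
have h4 := ler_normM_bound hey hey.
have h5 : t * (2 * (px * zx + py * zy) + (zx ^+ 2 + zy ^+ 2)) <= 0.
  by rewrite mulr_ge0_le0 //; lra.
have h6 : 0 <= (1 - t) * (r ^+ 2 - (zx ^+ 2 + zy ^+ 2)).
  by rewrite mulr_ge0 //; lra.
(* These squares absorb the mixed term 2 t p.e into t^2 |p|^2 + |e|^2, which doubles both terms. *)
have h7 := sqr_ge0 (t * px - ex).
have h8 := sqr_ge0 (t * py - ey).
lra.
Qed.

(** Expand |p - w|^2 with w = t p + e. Once the mixed term 2 t p.e is absorbed into squares, the
    gain is 2 t (1 - t) |p|^2, at least t m^2 / 2 for t <= 3/4, and the error costs at most 4 e m +
    4 e^2. *)
Lemma lens_closer (R : realFieldType) (t e m px py wx wy : R) :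
  0 <= t <= 3 / 4 ->
  `|wx - t * px| <= e -> `|wy - t * py| <= e ->
  `|px| <= m -> `|py| <= m -> m ^+ 2 <= px ^+ 2 + py ^+ 2 ->
  4 * e * m + 4 * e ^+ 2 < t * m ^+ 2 / 2 ->
  (px - wx) ^+ 2 + (py - wy) ^+ 2 < px ^+ 2 + py ^+ 2.
Proof.
move=> /andP[t0 t1]; set ex := wx - t * px; set ey := wy - t * py.
move=> hex hey pxm pym hm he.
have -> : wx = t * px + ex by rewrite /ex; ring.
have -> : wy = t * py + ey by rewrite /ey; ring.
have h1 := ler_normM_bound hex pxm.
have h2 := ler_normM_bound hey pym.
have := hex; rewrite -normrN => hex'; have := hey; rewrite -normrN => hey'.
have h1' := ler_normM_bound hex' pxm.
have h2' := ler_normM_bound hey' pym.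
have h3 := ler_normM_bound hex hex.
have h4 := ler_normM_bound hey hey.
have h7 := sqr_ge0 (t * px - ex).
have h8 := sqr_ge0 (t * py - ey).
have h9 : 0 <= t * (px ^+ 2 + py ^+ 2 - m ^+ 2) by rewrite mulr_ge0 //; lra.
have h10 : 0 <= t * (3 / 4 - t) * (px ^+ 2 + py ^+ 2).
  by rewrite mulr_ge0 ?addr_ge0 ?sqr_ge0 // mulr_ge0 // subr_ge0.
lra.
Qed.

Lemma max_norm_bounds (R : realFieldType) (x y m : R) :
  m = Num.max `|x| `|y| ->
  [/\ `|x| <= m, `|y| <= m, m ^+ 2 <= x ^+ 2 + y ^+ 2 &
      x ^+ 2 + y ^+ 2 <= 2 * m ^+ 2].
Proof.
move=> ->; have hx := sqr_ge0 x; have hy := sqr_ge0 y.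
have [xy|/ltW xy] := leP `|x| `|y|; split => //; rewrite real_normK ?num_real //.
- by lra.
- have: `|x| ^+ 2 <= `|y| ^+ 2 by rewrite ler_pXn2r ?nnegrE.
  by rewrite !real_normK ?num_real //; lra.
- by lra.
- have: `|y| ^+ 2 <= `|x| ^+ 2 by rewrite ler_pXn2r ?nnegrE.
  by rewrite !real_normK ?num_real //; lra.
Qed.

(** Passes between a vertex p' outside the central disc of radius r / 2 and the corner p of its
    cell. There r^2 < 4 |p'|^2 <= 8 m'^2 gives r < 3 m', and s is so small against r that m and m'
    are comparable. *)
Lemma grid_max_norm (R : realFieldType) (r s m px py px' py' : R) :
  0 < r -> r ^+ 2 < 2 -> 0 <= s -> 10000 * s <= r ^+ 3 ->
  `|px' - px| <= s -> `|py' - py| <= s -> `|px'| <= 1 / 2 -> `|py'| <= 1 / 2 ->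
  r ^+ 2 < 4 * (px' ^+ 2 + py' ^+ 2) -> m = Num.max `|px| `|py| ->
  exists m', [/\ m' = Num.max `|px'| `|py'|, 0 <= m' <= 1 / 2,
    m' <= m + s, m <= m' + s & [/\ r <= 3 / 2, r < 3 * m', 5000 * s <= r & r <= 4 * m]].
Proof.
move=> r0 r2 s0 sr hpx hpy hpx1 hpy1 hp mE.
have [pxm pym _ _] := max_norm_bounds mE.
have [m' m'E] : exists m', m' = Num.max `|px'| `|py'| by eexists.
exists m'.
have [pxm' pym' hm1 hm2] := max_norm_bounds m'E.
have m'1 : m' <= 1 / 2 by rewrite m'E ge_max hpx1.
have m'0 : 0 <= m' by rewrite (le_trans _ pxm').
have m'm : m' <= m + s.
  rewrite m'E ge_max; apply/andP; split.
    by have := ler_normD (px' - px) px; rewrite subrK; move: hpx pxm; clear; lra.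
  by have := ler_normD (py' - py) py; rewrite subrK; move: hpy pym; clear; lra.
have mm' : m <= m' + s.
  rewrite mE ge_max; apply/andP; split.
    have := ler_normB px' (px' - px); rewrite opprB addrC subrK.
    by move: hpx pxm'; clear; lra.
  have := ler_normB py' (py' - py); rewrite opprB addrC subrK.
  by move: hpy pym'; clear; lra.
have r1 : r <= 3 / 2.
  rewrite leNgt; apply/negP => r3; have : 3 / 2 * (3 / 2) < r * r by rewrite ltr_pM.
  by move: r2; clear; lra.
have rm' : r < 3 * m'.
  rewrite ltNge; apply/negP => r3; have : 3 * m' * (3 * m') <= r * r.
    by rewrite ler_pM // mulr_ge0.
  by have := sqr_ge0 m'; move: hp hm2 r0; clear; have := sqr_ge0 r; lra.
have r3 : r ^+ 3 <= 2 * r.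
  have -> : r ^+ 3 = r ^+ 2 * r by rewrite exprSr.
  by rewrite ler_wpM2r // ltW.
have sr1 : 5000 * s <= r by move: sr r3; clear; lra.
have m4 : r <= 4 * m by move: sr1 mm' m'm rm' r0; clear; lra.
by split => //; rewrite m'0.
Qed.

(* [p] is the corner of the grid cell of [p'], and [q] lies in the cell of
   [(1 - t) p]. *)
Lemma grid_lens (R : realFieldType) (r s t m px py px' py' qx qy : R) :
  0 < r -> r ^+ 2 < 2 -> 0 <= s -> 10000 * s <= r ^+ 3 ->
  `|px' - px| <= s -> `|py' - py| <= s -> `|px'| <= 1 / 2 -> `|py'| <= 1 / 2 ->
  r ^+ 2 < 4 * (px' ^+ 2 + py' ^+ 2) ->
  m = Num.max `|px| `|py| -> r ^+ 2 / 16 <= t * m <= r ^+ 2 / 8 ->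
  `|qx - (1 - t) * px| <= s -> `|qy - (1 - t) * py| <= s ->
  qx ^+ 2 + qy ^+ 2 < px' ^+ 2 + py' ^+ 2 /\
  forall x y : R, x ^+ 2 + y ^+ 2 <= px' ^+ 2 + py' ^+ 2 ->
    (px' - x) ^+ 2 + (py' - y) ^+ 2 <= r ^+ 2 ->
    (qx - x) ^+ 2 + (qy - y) ^+ 2 <= r ^+ 2.
Proof.
move=> r0 r2 s0 sr hpx hpy hpx1 hpy1 hp mE /andP[ta1 ta2] hqx hqy.
have [m' [m'E /andP[m'0 m'1] m'm mm' [r1 rm' sr1 m4]]] :=
  grid_max_norm r0 r2 s0 sr hpx hpy hpx1 hpy1 hp mE.
have [pxm' pym' hm1 hm2] := max_norm_bounds m'E.
have m2' : m' <= 2 * m by move: sr1 m4 m'm r0; clear; lra.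
have m2 : m <= 2 * m' by move: sr1 mm' rm' r0; clear; lra.
have m0 : 0 < m by move: m4 r0; clear; lra.
have rr0 : 0 < r ^+ 2 by rewrite exprn_gt0.
have t0 : 0 < t by rewrite -(pmulr_lgt0 _ m0); move: ta1 rr0; clear; lra.
have t1 : t <= r / 2.
  rewrite -(ler_pM2r r0); have : t * r <= t * (4 * m) by rewrite ler_wpM2l // ltW.
  by move: ta2; clear; lra.
have tm2 : t * m <= 2 * (t * m').
  by rewrite mulrCA ler_wpM2l // ltW.
have tm2' : t * m' <= 2 * (t * m).
  by rewrite mulrCA ler_wpM2l // ltW.
have ht : `|1 - t| <= 1 by rewrite ler_norml; move: t0 t1 r1; clear; lra.
(* The displacement p' - q is t p' up to 2 s per coordinate: one mesh for p' against its corner, one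
   for q in its cell. *)
have hw a a' b : `|a' - a| <= s -> `|b - (1 - t) * a| <= s ->
    `|(a' - b) - t * a'| <= 2 * s.
  move=> ha hb.
  have -> : (a' - b) - t * a' = (1 - t) * (a' - a) - (b - (1 - t) * a) by ring.
  rewrite (le_trans (ler_normB _ _)) // normrM.
  by have := ler_pM (normr_ge0 _) (normr_ge0 _) ht ha; move: hb; clear; lra.
have hwx := hw _ _ _ hpx hqx; have hwy := hw _ _ _ hpy hqy.
have t34 : 0 <= t <= 3 / 4 by move: t0 t1 r1; clear; lra.
have t01 : 0 <= t <= 1 by move: t0 t1 r1; clear; lra.
have s1 : 5000 * s <= r ^+ 2.
  have : r ^+ 2 * r <= r ^+ 2 * (3 / 2) by rewrite ler_wpM2l // ltW.
  by rewrite -exprSr; move: sr rr0; clear; lra.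
split.
  (* The gain t m'^2 / 2 is at least r^2 m' / 64; the mesh errors cost at most 24 s m', with 5000 s
     <= r^2. *)
  have := lens_closer t34 hwx hwy pxm' pym' hm1; rewrite !subKr; apply.
  have : r ^+ 2 / 32 * m' <= t * m' * m'.
    by rewrite ler_wpM2r //; move: tm2 ta1; clear; lra.
  have : s * s <= s * m' by rewrite ler_wpM2l //; move: sr1 rm' r0; clear; lra.
  have : 5000 * s * m' <= r ^+ 2 * m' by rewrite ler_wpM2r.
  have : 0 < r ^+ 2 * m' by rewrite mulr_gt0 //; move: rm' r0; clear; lra.
  by clear; lra.
move=> x y hxy hd.
(* In [lens_dominates], z runs from p' to its neighbour and w from q to p'. *)
rewrite -[qx - x](_ : - ((x - px') + (px' - qx)) = _); last by clear; ring.
rewrite -[qy - y](_ : - ((y - py') + (py' - qy)) = _); last by clear; ring.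
rewrite !sqrrN; apply: (@lens_dominates _ r t (2 * s) px' py') => //.
- exact: ltW.
(* The term 2 t^2 |p'|^2 takes at most half of t r^2, because t m' <= r^2 / 4 and m' <= 1/2. The
   mesh errors, at most 24 s r, fit in the other half, because t r^2 >= r^4 / 16 and 10000 s <=
   r^3. *)
- have h1 : t * (px' ^+ 2 + py' ^+ 2) * t <= t * (2 * m' ^+ 2) * t.
    by rewrite ler_wpM2r ?(ltW t0) // ler_wpM2l ?(ltW t0).
  have h2 : t * m' * (m' * t) <= r ^+ 2 / 4 * (m' * t).
    by rewrite ler_wpM2r ?mulr_ge0 ?(ltW t0) //; move: tm2' ta2; clear; lra.
  have h3 : m' * (t * r ^+ 2) <= 1 / 2 * (t * r ^+ 2).
    by rewrite ler_wpM2r // mulr_ge0 ?sqr_ge0 // ltW.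
  have h4 : r ^+ 2 / 16 * r ^+ 2 <= t * r ^+ 2.
    rewrite ler_wpM2r ?sqr_ge0 //.
    have : t * m <= t * 1.
      by rewrite ler_wpM2l ?(ltW t0) //; move: m2 m'1; clear; lra.
    by move: ta1; clear; lra.
  have h5 : s * s <= s * r by rewrite ler_wpM2l //; move: sr1 s0; clear; lra.
  have h6 : 10000 * s * r <= r ^+ 3 * r by rewrite ler_wpM2r // ltW.
  have h7 : 0 <= t * r ^+ 2 by rewrite mulr_ge0 ?sqr_ge0 ?(ltW t0).
  by move: h1 h2 h3 h4 h5 h6 h7; clear; lra.
- by rewrite -[x - px']opprB -[y - py']opprB !sqrrN.
- by rewrite !(addrC _ (_ - _)) !subrK.
Qed.

(** * Lenses in the grid *)

Section Grid.
Variables (R : realType) (M : nat).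
Let side : R := M.+1%:R^-1.

(** Half-open, so that cells are disjoint; within [0, 1] only the point 1 is left out. *)
Definition in_cell (x : R) (k : 'I_M.+1) : bool :=
  k%:R / M.+1%:R <= x < k.+1%:R / M.+1%:R.

Definition cell_of (x : R) : 'I_M.+1 := inord (Num.truncn (x * M.+1%:R)).

(* Coordinates are recentred at the centre (1/2, 1/2) of the square. *)
Definition corner (k : 'I_M.+1) : R := k%:R / M.+1%:R - 1 / 2.

Definition corner_norm (c : 'I_M.+1 * 'I_M.+1) : R :=
  Num.max `|corner c.1| `|corner c.2|.

(* Successive multiples [(1 - lens_shift k) * p] differ by exactly one mesh in
   the larger coordinate of [p], so they lie in distinct cells. *)
Definition lens_shift (r : R) (c : 'I_M.+1 * 'I_M.+1) (k : nat) : R :=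
  (r ^+ 2 / 16 + k%:R / M.+1%:R) / corner_norm c.

(** The number of whole meshes between r^2 / 16 and r^2 / 8, the range allowed for the displacement
    in max norm. *)
Definition lens_size (r : R) : nat := Num.truncn (r ^+ 2 / 16 * M.+1%:R).

Definition lens_cell (r : R) (c : 'I_M.+1 * 'I_M.+1) (k : nat) :
    'I_M.+1 * 'I_M.+1 :=
  (cell_of (1 / 2 + (1 - lens_shift r c k) * corner c.1),
   cell_of (1 / 2 + (1 - lens_shift r c k) * corner c.2)).

Definition lens (r : R) (c : 'I_M.+1 * 'I_M.+1) : {set 'I_M.+1 * 'I_M.+1} :=
  [set lens_cell r c (val k) | k : 'I_(lens_size r)]%SET.

Lemma in_cellE (x : R) k : in_cell x k = (k%:R / M.+1%:R <= x < k%:R / M.+1%:R + side).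
Proof. by rewrite /in_cell -[k.+1%:R]natr1 mulrDl mul1r. Qed.

Lemma cell_ofE (x : R) : 0 <= x < 1 -> cell_of x = Num.truncn (x * M.+1%:R) :> nat.
Proof.
move=> /andP[x0 x1]; rewrite inordK // truncn_lt_nat ?mulr_ge0 //.
by rewrite -[ltRHS]mul1r ltr_pM2r // ltr0n.
Qed.

Lemma in_cell_of (x : R) : 0 <= x < 1 -> in_cell x (cell_of x).
Proof.
move=> x01; rewrite /in_cell cell_ofE // ler_pdivrMr ?ltr0n //.
rewrite ltr_pdivlMr ?ltr0n //; apply: truncn_itv.
by case/andP: x01 => x0 _; rewrite mulr_ge0.
Qed.

Lemma in_cell_close (x y : R) k : in_cell x k -> in_cell y k -> `|x - y| <= side.
Proof.
rewrite !in_cellE ler_norml; move: (k%:R / _) side => a s.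
by move=> /andP[? ?] /andP[? ?]; lra.
Qed.

Lemma in_cell_corner (x : R) k : in_cell x k -> `|(x - 1 / 2) - corner k| <= side.
Proof.
rewrite in_cellE ler_norml /corner; move: (k%:R / _) side => a s.
by move=> /andP[? ?]; lra.
Qed.

Lemma corner_ge k : - (1 / 2) <= corner k.
Proof. by rewrite /corner lerBrDr addNr divr_ge0. Qed.

Lemma corner_lt k : corner k < 1 / 2.
Proof.
suff : k%:R / M.+1%:R < 1 :> R by rewrite /corner; move: (k%:R / _) => a; lra.
by rewrite ltr_pdivrMr ?ltr0n // mul1r ltr_nat.
Qed.

Lemma in_cell01 (x : R) k : in_cell x k -> `|x - 1 / 2| <= 1 / 2.
Proof.
move=> /andP[h1 h2]; have : 0 <= k%:R / M.+1%:R :> R by rewrite divr_ge0.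
have : k.+1%:R / M.+1%:R <= 1 :> R.
  by rewrite ler_pdivrMr ?ltr0n // mul1r ler_nat.
by move: h1 h2; rewrite ler_norml; move: (k%:R / _) (k.+1%:R / _) => a b; lra.
Qed.

Lemma cell_of_neq (x y : R) : 0 <= x < 1 -> 0 <= y < 1 -> side <= `|x - y| ->
  cell_of x != cell_of y.
Proof.
move=> x01 y01; apply: contraTneq => xy; rewrite -ltNge.
have := in_cell_of x01; have := in_cell_of y01; rewrite xy !in_cellE.
rewrite ltr_norml; move: (_%:R / _) side => a s.
by move=> /andP[? ?] /andP[? ?]; lra.
Qed.

Section Lens.
Variables (r : R) (c : 'I_M.+1 * 'I_M.+1).
Hypotheses (r0 : 0 < r) (r2 : r ^+ 2 < 2) (far : r <= 4 * corner_norm c).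

Let m0 : 0 < corner_norm c. Proof. by move: r0 far; lra. Qed.

Lemma lens_shiftM k :
  lens_shift r c k * corner_norm c = r ^+ 2 / 16 + k%:R / M.+1%:R.
Proof. by rewrite divfK // gt_eqF. Qed.

Lemma lens_shift_bounds k : (k < lens_size r)%N ->
  r ^+ 2 / 16 <= lens_shift r c k * corner_norm c <= r ^+ 2 / 8.
Proof.
rewrite /lens_size truncn_gt_nat -ler_pdivrMr ?ltr0n // -[k.+1%:R]natr1 mulrDl.
have : 0 <= k%:R / M.+1%:R :> R by rewrite divr_ge0.
have : 0 < 1 / M.+1%:R :> R by rewrite divr_gt0 ?ltr0n.
by rewrite lens_shiftM; move: (k%:R / _) (1 / _) => a b; lra.
Qed.

Lemma lens_shift01 k : (k < lens_size r)%N -> 0 <= lens_shift r c k <= 1.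
Proof.
move=> /lens_shift_bounds/andP[h1 h2]; have := sqr_ge0 r => r20.
have r1 : r <= 2.
  by rewrite -(ler_pXn2r (ltn0Sn 1)) ?nnegrE ?ltW //; move: r2; lra.
have : r * r <= r * 2 by rewrite ler_wpM2l // ltW.
move=> rr; apply/andP; split.
  by rewrite -(pmulr_lge0 _ m0); move: h1 r20; lra.
by rewrite -(ler_pM2r m0) mul1r; move: h2 far r0 rr; lra.
Qed.

Lemma lens_coord01 t k : 0 <= t <= 1 -> 0 <= 1 / 2 + (1 - t) * corner k < 1.
Proof.
move=> /andP[t0 t1]; have h1 := corner_ge k; have h2 := corner_lt k.
have : 0 <= (1 - t) * (corner k + 1 / 2) by rewrite mulr_ge0; lra.
have : 0 <= (1 - t) * (1 / 2 - corner k) by rewrite mulr_ge0; lra.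
have : t = 1 \/ t < 1 by move: t1; rewrite le_eqVlt => /orP[/eqP|]; [left|right].
move=> [->|tt]; first by lra.
have : 0 < (1 - t) * (1 / 2 - corner k) by rewrite mulr_gt0; lra.
by lra.
Qed.

Lemma lens_cell_inj : injective (fun k : 'I_(lens_size r) => lens_cell r c (val k)).
Proof.
move=> k l; apply: contra_eq => kl.
have kl1 : 1 <= `|(val k)%:R - (val l)%:R| :> R.
  have nkl : val k != val l by [].
  have : (val k < val l)%N || (val l < val k)%N by rewrite -neq_ltn.
  by case/orP; rewrite -(ler_nat R) -natr1 => h; rewrite ler_normr; move: h; lra.
have t01 := lens_shift01 (ltn_ord k); have t01' := lens_shift01 (ltn_ord l).
(* In a coordinate attaining the max norm, the two points differ by |k - l| meshes. *)
have gap x : `|x| = corner_norm c ->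
    side <= `|1 / 2 + (1 - lens_shift r c k) * x - (1 / 2 + (1 - lens_shift r c l) * x)|.
  move=> xm.
  have -> : 1 / 2 + (1 - lens_shift r c k) * x - (1 / 2 + (1 - lens_shift r c l) * x) =
    - ((lens_shift r c k - lens_shift r c l) * x) by ring.
  rewrite normrN normrM xm -[in leRHS](ger0_norm (ltW m0)) -normrM mulrBl !lens_shiftM.
  rewrite opprD addrACA subrr add0r -mulrBl normrM [X in _ * X]ger0_norm //.
  by rewrite ler_peMl ?invr_ge0.
apply/eqP => -[].
have [cm|cm] : `|corner c.1| = corner_norm c \/ `|corner c.2| = corner_norm c.
  by rewrite /corner_norm; case: leP; [right|left].
- by move=> /eqP e _; move: e; apply/negP/cell_of_neq; rewrite ?lens_coord01 ?gap.
- by move=> _ /eqP; apply/negP/cell_of_neq; rewrite ?lens_coord01 ?gap.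
Qed.

Lemma card_lens : #|lens r c| = lens_size r.
Proof. by rewrite card_imset ?card_ord //; exact: lens_cell_inj. Qed.

(** Turns membership in a lens cell into the hypotheses of [grid_lens]: such a point shares a cell
    with a multiple (1 - t) of the corner. *)
Lemma lens_spec (x y : R) (q : 'I_M.+1 * 'I_M.+1) :
  q \in lens r c -> in_cell x q.1 -> in_cell y q.2 ->
  exists t, [/\ r ^+ 2 / 16 <= t * corner_norm c <= r ^+ 2 / 8,
    `|(x - 1 / 2) - (1 - t) * corner c.1| <= side &
    `|(y - 1 / 2) - (1 - t) * corner c.2| <= side].
Proof.
case/imsetP => k _ -> hx hy; exists (lens_shift r c k).
have t01 := lens_shift01 (ltn_ord k).
split; first exact: lens_shift_bounds.
  by rewrite -addrA -opprD; apply: (in_cell_close hx); exact/in_cell_of/lens_coord01.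
by rewrite -addrA -opprD; apply: (in_cell_close hy); exact/in_cell_of/lens_coord01.
Qed.

End Lens.
End Grid.

(** * Deterministic and counting arguments *)

Lemma game_step_rggP (R : realType) n (x y : 'I_n -> R) (r : R) i j :
  game_step (rgg_adj x y r) i j <->
  (x i - x j) ^+ 2 + (y i - y j) ^+ 2 <= r ^+ 2.
Proof.
split=> [[->|/andP[]//]|h]; first by rewrite !subrr expr0n /= addr0 sqr_ge0.
by have [->|ij] := eqVneq i j; [left | right; rewrite /rgg_adj ij].
Qed.

Lemma rgg_adj_sym (R : realType) n (x y : 'I_n -> R) (r : R) :
  symmetric (rgg_adj x y r).
Proof.
move=> i j; rewrite /rgg_adj eq_sym.
by rewrite -(opprB (x j)) -(opprB (y j)) !sqrrN.
Qed.

Lemma cops_win_clique (R : realType) n (x y : 'I_n -> R) (r : R) (i0 : 'I_n) :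
  (forall i, 0 <= x i <= 1) -> (forall i, 0 <= y i <= 1) -> 2 <= r ^+ 2 ->
  cops_win (rgg_adj x y r) 1.
Proof.
move=> hx hy r2.
(* With constant height nothing needs dominating; the square has diameter sqrt 2 <= r, so the graph
   is a clique. *)
apply: (@cops_win_dismantle _ R _ _ (fun=> 0) 0 i0 (rgg_adj_sym x y r)); last first.
  by move=> i; rewrite ltxx.
have sq (a b : R) : 0 <= a <= 1 -> 0 <= b <= 1 -> (a - b) ^+ 2 <= 1.
  by move=> ha hb; rewrite -real_normK ?num_real // expr_le1 // ler_norml; lra.
move=> i j _ _; apply/game_step_rggP.
by have := sq _ _ (hx i) (hx j); have := sq _ _ (hy i) (hy j); lra.
Qed.

Lemma cops_win_grid (R : realType) n M (x y : 'I_n -> R) (r : R) (i0 : 'I_n)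
    (f : 'I_n -> 'I_M.+1 * 'I_M.+1) :
  0 < r -> r ^+ 2 < 2 -> 10000 / M.+1%:R <= r ^+ 3 ->
  (forall i, in_cell (x i) (f i).1) -> (forall i, in_cell (y i) (f i).2) ->
  (forall c, r <= 4 * corner_norm R c -> exists i, f i \in lens r c) ->
  cops_win (rgg_adj x y r) 1.
Proof.
move=> r0 r2 rM hx hy hf.
have s0 : 0 <= M.+1%:R^-1 :> R by rewrite invr_ge0.
pose u i := x i - 1 / 2; pose v i := y i - 1 / 2.
have duv (a : 'I_n -> R) i j : a i - a j = (a i - 1 / 2) - (a j - 1 / 2).
  by ring.
apply: (@cops_win_dismantle _ R _ _ (fun i => u i ^+ 2 + v i ^+ 2) (r ^+ 2 / 4)
  i0 (rgg_adj_sym x y r)).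
  (* Parallelogram identity: two points within r / 2 of the centre are within r of each other. *)
  move=> i j hi hj; apply/game_step_rggP; rewrite !(duv x) !(duv y) -/(u i) -/(u j) -/(v i) -/(v j).
  by have := sqr_ge0 (u i + u j); have := sqr_ge0 (v i + v j); lra.
move=> i hi.
have hp : r ^+ 2 < 4 * (u i ^+ 2 + v i ^+ 2) by lra.
have [m' [_ _ _ _ [_ _ _ far]]] := grid_max_norm r0 r2 s0 rM
  (in_cell_corner (hx i)) (in_cell_corner (hy i)) (in_cell01 (hx i)) (in_cell01 (hy i)) hp erefl.
have [j fj] := hf _ far.
have [t [ht hu hv]] := lens_spec r0 r2 far fj (hx j) (hy j).
have [closer dominates] := grid_lens r0 r2 s0 rM
  (in_cell_corner (hx i)) (in_cell_corner (hy i)) (in_cell01 (hx i)) (in_cell01 (hy i)) hp erefl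
  ht hu hv.
exists j => // k hk /game_step_rggP; rewrite (duv x) (duv y) => hik.
by apply/game_step_rggP; rewrite (duv x) (duv y); exact: dominates.
Qed.

(** Union bound in counting form: a map avoiding [S c] takes its n values in the complement of
    [S c]. *)
Lemma card_missing n (C : finType) (far : pred C) (S : C -> {set C}) (K : nat) :
  (forall c, far c -> (K <= #|S c|)%N) ->
  (#|[set f : {ffun 'I_n -> C} |
      [exists c, far c && [forall i, f i \notin S c]]]%SET| <= #|C| * (#|C| - K) ^ n)%N.
Proof.
move=> hS; pose A c := [set f : {ffun 'I_n -> C} | [forall i, f i \notin S c]]%SET.
have -> : [set f : {ffun 'I_n -> C} |
      [exists c, far c && [forall i, f i \notin S c]]]%SET = (\bigcup_(c | far c) A c)%SET.
  apply/setP => f; rewrite inE; apply/existsP/finset.bigcupP.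
    by move=> [c /andP[fc h]]; exists c => //; rewrite inE.
  by move=> [c fc]; rewrite inE => h; exists c; rewrite fc.
apply: (@leq_trans (\sum_(c | far c) #|A c|)%N).
  elim/big_rec2: _ => [|c s B _ IH]; first by rewrite cards0.
  by apply: leq_trans (leq_card_setU _ _) _; rewrite leq_add2l.
apply: (@leq_trans (\sum_(c | far c) (#|C| - K) ^ n)%N).
  apply: leq_sum => c fc.
  have -> : #|A c| = #|@ffun_on 'I_n (~: S c)%SET|.
    rewrite cardsE; apply: eq_card => f; rewrite unfold_in.
    apply/forallP/ffun_onP => h i; first by rewrite inE.
    by have := h i; rewrite inE.
  (* [leq_exp2r] asks for a positive exponent; at n = 0 both powers are 1. *)
  have leq_exp a b : (a <= b -> a ^ n <= b ^ n)%N.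
    by case: (n) => // n' ab; rewrite leq_exp2r.
  by rewrite card_ffun_on card_ord leq_exp // cardsCs finset.setCK leq_sub2l ?hS.
by rewrite sum_nat_const leq_mul2r max_card orbT.
Qed.

(** * Probability of the cell configurations *)

(** Any graph property is a finite union, over the adjacency matrices [g] satisfying it, of finite
    intersections of measurable edge conditions. *)
Lemma measurable_rgg_event (R : realType) (d : measure_display) (T : measurableType d)
    n (X Y : 'I_n -> T -> R) (r : R) (Q : rel 'I_n -> Prop) :
  (forall i, measurable_fun setT (X i)) -> (forall i, measurable_fun setT (Y i)) ->
  measurable [set w | Q (rgg_adj (X ^~ w) (Y ^~ w) r)].
Proof.
move=> mX mY.
pose E (g : {ffun 'I_n * 'I_n -> bool}) (e : 'I_n * 'I_n) :=
  [set w | rgg_adj (X ^~ w) (Y ^~ w) r e.1 e.2 = g e].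
have -> : [set w | Q (rgg_adj (X ^~ w) (Y ^~ w) r)] =
    \bigcup_(g in [set g : {ffun 'I_n * 'I_n -> bool} | Q (fun i j => g (i, j))])
      \bigcap_(e in [set: 'I_n * 'I_n]) E g e.
  apply/seteqP; split => [w Qw|w [g Qg wg]].
    exists [ffun e => rgg_adj (X ^~ w) (Y ^~ w) r e.1 e.2]; last by move=> e _; rewrite /E /= ffunE.
    by congr Q: Qw; apply/funext => i; apply/funext => j; rewrite ffunE.
  by congr Q: Qg; apply/funext => i; apply/funext => j; rewrite -wg.
apply: fin_bigcup_measurable => [|g _]; first exact: finite_finset.
apply: fin_bigcap_measurable => [|[i j] _]; first exact: finite_finset.
have mle : measurable [set w | rgg_adj (X ^~ w) (Y ^~ w) r i j].
  have [<-|ij] := eqVneq i j.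
    by rewrite (_ : [set w | _] = set0) //; apply/seteqP; split => w //=; rewrite /rgg_adj eqxx.
  rewrite (_ : [set w | _] = setT `&`
    [set w | (X i w - X j w) ^+ 2 + (Y i w - Y j w) ^+ 2 <= r ^+ 2]).
    apply: measurable_fun_le => //.
    by apply: measurable_funD; apply: measurable_funX; apply: measurable_funB.
  by rewrite setTI; apply/seteqP; split => w; rewrite /= /rgg_adj ij.
rewrite /E /=; case: (g (i, j)) => //.
rewrite (_ : [set w | _] = ~` [set w | rgg_adj (X ^~ w) (Y ^~ w) r i j]).
  exact: measurableC.
by apply/seteqP; split => w /= /negP; rewrite ?negbK; case: rgg_adj.
Qed.

Lemma in_cell_inj (R : realType) M (x : R) (k l : 'I_M.+1) :
  in_cell x k -> in_cell x l -> k = l.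
Proof.
suff lekl (a b : 'I_M.+1) : in_cell x a -> in_cell x b -> (a <= b)%N.
  by move=> hk hl; apply/val_inj/eqP; rewrite eqn_leq !lekl.
move=> /andP[h1 _] /andP[_ h2]; have := le_lt_trans h1 h2.
by rewrite ltr_pM2r ?invr_gt0 ?ltr0n // ltr_nat ltnS.
Qed.

Definition cells_event (R : realType) (d : measure_display) (T : measurableType d)
    n (X Y : 'I_n -> T -> R) M (f : {ffun 'I_n -> 'I_M.+1 * 'I_M.+1}) : set T :=
  \bigcap_(i in [set: 'I_n]) (X i @^-1` [set x | in_cell x (f i).1] `&`
                              Y i @^-1` [set y | in_cell y (f i).2]).

Lemma in_cell_itv (R : realType) M (k : 'I_M.+1) :
  [set x : R | in_cell x k] = `[k%:R / M.+1%:R, k.+1%:R / M.+1%:R[%classic.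
Proof. by apply/seteqP; split => x; rewrite /= in_itv. Qed.

Lemma lebesgue_in_cell (R : realType) M (k : 'I_M.+1) :
  lebesgue_measure ([set x : R | in_cell x k] `&` `[0, 1]) = (M.+1%:R^-1)%:E.
Proof.
rewrite (_ : _ `&` _ = [set x : R | in_cell x k]).
  rewrite in_cell_itv lebesgue_measure_itv /= lte_fin ltr_pM2r ?invr_gt0 ?ltr0n //.
  by rewrite ltr_nat ltnSn -EFinB -mulrBl -natrB // subSnn mul1r.
apply: setIidl => x /in_cell01; rewrite /= in_itv /= ler_norml => ?; lra.
Qed.

Section CellsEvent.
Variables (R : realType) (d : measure_display) (T : measurableType d)
  (P : probability T R) (n : nat) (X Y : 'I_n -> T -> R) (M : nat).
Hypothesis iid : iid_uniform_square P X Y.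

Lemma measurable_in_cell (k : 'I_M.+1) : measurable [set x : R | in_cell x k].
Proof. by rewrite in_cell_itv; exact: measurable_itv. Qed.

Lemma measurable_cells_event (f : {ffun 'I_n -> 'I_M.+1 * 'I_M.+1}) :
  measurable (cells_event X Y f).
Proof.
case: iid => mX [mY _]; apply: fin_bigcap_measurable => [|i _]; first exact: finite_finset.
apply: measurableI; rewrite -[_ @^-1` _]setTI.
  by apply: mX => //; exact: measurable_in_cell.
by apply: mY => //; exact: measurable_in_cell.
Qed.

Lemma prob_cells_event (f : {ffun 'I_n -> 'I_M.+1 * 'I_M.+1}) :
  P (cells_event X Y f) = ((M.+1%:R ^- 2) ^+ n)%:E.
Proof.
case: iid => _ [_ ->]; try by move=> i; exact: measurable_in_cell.
under eq_bigr do rewrite !lebesgue_in_cell -EFinM -invfM -expr2.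
by rewrite prodEFin prodr_const card_ord.
Qed.

(** Turns counting into probability: the cell events of distinct [f] are disjoint and equally
    likely. *)
Lemma prob_ge_cells (good : {set {ffun 'I_n -> 'I_M.+1 * 'I_M.+1}}) (D : set T) :
  measurable D -> (forall f, f \in good -> cells_event X Y f `<=` D) ->
  ((#|good|%:R * (M.+1%:R ^- 2) ^+ n)%:E <= P D)%E.
Proof.
move=> mD goodD.
apply: (@le_trans _ _ (P (\bigcup_(f in [set f | f \in good]) cells_event X Y f))).
  rewrite measure_fin_bigcup //.
  - rewrite (fsbigE (enum good)) ?enum_uniq //.
    + rewrite (eq_bigr (fun=> ((M.+1%:R ^- 2) ^+ n)%:E)) => [|f _]; last exact: prob_cells_event.
      rewrite big_enum_cond (eq_bigl (mem good)) => [|f]; last first.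
        by rewrite !inE; case: (boolP (f \in good)) => //= fg; apply/mem_set.
      by rewrite sumEFin sumr_const mulr_natl.
    + by move=> f /=; rewrite mem_enum.
    + by move=> f /= fg; rewrite mem_enum fg.
  - move=> f g _ _ [w [wf wg]]; apply/ffunP => i.
    have [h1 h2] := wf i I; have [h3 h4] := wg i I.
    by rewrite [f i]surjective_pairing [g i]surjective_pairing (in_cell_inj h1 h3) (in_cell_inj h2 h4).
  - by move=> f _; exact: measurable_cells_event.
apply: le_measure; rewrite ?inE //.
  by apply: fin_bigcup_measurable => [|f _]; [exact: finite_finset|exact: measurable_cells_event].
by move=> w [f fg wf]; exact: goodD fg _ wf.
Qed.
End CellsEvent.

(** * The estimate *)

Lemma cube_le3 (R : realFieldType) (r : R) : 0 < r -> r ^+ 2 < 2 -> r ^+ 3 <= 3.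
Proof.
move=> r0 r2; have r1 : r <= 3 / 2.
  rewrite leNgt; apply/negP => r3; have : 3 / 2 * (3 / 2) < r * r by rewrite ltr_pM.
  by lra.
have -> : r ^+ 3 = r ^+ 2 * r by rewrite exprSr.
have : r ^+ 2 * r <= 2 * (3 / 2) by rewrite ler_pM ?sqr_ge0 ?(ltW r0) ?(ltW r2).
by lra.
Qed.

(** As b / a >= 1, the integer floor(b / a) + 1 lies between b / a and 2 b / a. *)
Lemma mesh_exists (R : realType) (a b : R) : 0 < a <= b ->
  exists M, b / M.+1%:R <= a /\ M.+1%:R * a <= 2 * b.
Proof.
move=> /andP[a0 ab]; exists (Num.truncn (b / a)).
have /truncn_itv/andP[h1 h2] : 0 <= b / a by rewrite divr_ge0 ?(le_trans (ltW a0)) // ltW.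
split; first by rewrite ler_pdivrMr ?ltr0n // -ler_pdivrMl // mulrC ltW.
move: (Num.truncn _) h1 => K; rewrite ler_pdivlMr // -[K.+1%:R]natr1 mulrDl mul1r.
by move: (K%:R * a) => x; lra.
Qed.

Lemma lens_size_bounds (R : realType) M (r : R) :
  0 < r -> r ^+ 2 < 2 -> 10000 / M.+1%:R <= r ^+ 3 ->
  (lens_size M r <= M.+1 * M.+1)%N /\ r ^+ 2 / 32 * M.+1%:R <= (lens_size M r)%:R.
Proof.
move=> r0 r2; rewrite ler_pdivrMr ?ltr0n // => rM.
have N0 : 0 < M.+1%:R :> R by rewrite ltr0n.
have x0 : 0 <= r ^+ 2 / 16 * M.+1%:R by rewrite !mulr_ge0 ?sqr_ge0 // ltW.
have /andP[h1 h2] := truncn_itv x0.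
rewrite -/(lens_size M r) in h1 h2; split.
  rewrite -(ler_nat R) natrM (le_trans h1) // ler_wpM2r ?ltW //.
  have : 1 <= M.+1%:R :> R by rewrite ler1n.
  by move: r2; clear; lra.
(* Rounding down loses less than 1, which is below r^2 N / 32, as r^2 N >= r^3 N / 2 >= 5000 with N
   = [M.+1]. *)
have r1 : r <= 2.
  by rewrite -(ler_pXn2r (ltn0Sn 1)) ?nnegrE ?ltW //; move: r2; clear; lra.
have : r ^+ 3 * M.+1%:R <= 2 * (r ^+ 2 * M.+1%:R).
  by rewrite exprS -mulrA ler_wpM2r // mulr_ge0 ?sqr_ge0 // ltW.
move: h2 rM; rewrite -[(lens_size M r).+1%:R]natr1.
by move: (M.+1%:R : R) ((lens_size M r)%:R : R) => N k; clear; lra.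
Qed.

(** At least r^2 N / 32 of the N^2 cells, with 1 / N >= r^3 / 20000: this is the area of order
    r^5. *)
Lemma lens_density (R : realType) M (r : R) :
  0 < r -> r ^+ 2 < 2 -> 10000 / M.+1%:R <= r ^+ 3 -> M.+1%:R * r ^+ 3 <= 2 * 10000 ->
  r ^+ 5 / (64 * 10000) <= (lens_size M r)%:R / M.+1%:R ^+ 2.
Proof.
move=> r0 r2 rM1 rM2; have [_ K2] := lens_size_bounds r0 r2 rM1.
have N0 : 0 < M.+1%:R :> R by rewrite ltr0n.
rewrite ler_pdivlMr ?exprn_gt0 // (le_trans _ K2) //.
have : r ^+ 2 * M.+1%:R * (M.+1%:R * r ^+ 3) <= r ^+ 2 * M.+1%:R * (2 * 10000).
  by rewrite ler_wpM2l // mulr_ge0 ?sqr_ge0 // ltW.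
by move: (M.+1%:R : R) => N; clear; lra.
Qed.

(* There are [N^2 = O(r^-6) = O(n^2)] cells, and each of them fails with
   probability at most [n^-3]. *)
Lemma failure_bound (R : realType) n (r N D : R) :
  (1 < n)%N -> 0 < r -> r ^+ 2 < 2 -> 1 <= D -> 0 <= N -> N * r ^+ 3 <= 2 * D ->
  192 * D * ln n%:R / n%:R < r ^+ 5 ->
  N ^+ 2 * (1 - r ^+ 5 / (64 * D)) ^+ n <= 16 * D ^+ 2 / n%:R.
Proof.
move=> n1 r0 r2 D1 N0 Nr rn.
have n0 : 0 < n%:R :> R by rewrite ltr0n ltnW.
have D0 : 0 < D by exact: lt_le_trans D1.
have r5 : r ^+ 5 <= 6.
  have -> : r ^+ 5 = r ^+ 2 * r ^+ 3 by rewrite -exprD.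
  have := ler_pM (sqr_ge0 r) (exprn_ge0 3 (ltW r0)) (ltW r2) (cube_le3 r0 r2).
  by clear; lra.
have ln_half : 1 / 2 <= ln n%:R :> R.
  have := expR_ge1Dx (- ln n%:R : R); rewrite expRN lnK ?posrE //.
  have : n%:R^-1 <= 2^-1 :> R by rewrite lef_pV2 ?posrE // ler_nat.
  by clear; lra.
rewrite ltr_pdivrMr // in rn.
(* By 1 - q <= exp(- q) it suffices that n q >= 3 ln n; hence 192 = 3 * 64. *)
have pow : (1 - r ^+ 5 / (64 * D)) ^+ n <= n%:R ^- 3.
  apply: (@le_trans _ _ (expR (- (r ^+ 5 / (64 * D))) ^+ n)).
    apply: lerXn2r; rewrite ?nnegrE ?expR_ge0 ?expR_ge1Dx // subr_ge0.
    by rewrite ler_pdivrMr ?mulr_gt0 // mul1r; move: r5 D1; clear; lra.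
  rewrite -expRM_natl -[n%:R in leRHS](@lnK R) ?posrE // -expRM_natl -expRN ler_expR.
  rewrite mulrN lerN2 mulrA ler_pdivlMr ?mulr_gt0 //.
  by move: rn; move: (ln _) => L; clear; lra.
have nr : 1 <= n%:R * r ^+ 5.
  have : 1 * (1 / 2) <= D * ln n%:R by rewrite ler_pM.
  by move: rn; move: (ln _) => L; clear; lra.
(* Square n r^5 >= 1 and bound r^4 by 4; multiplying N^2 by this makes (N r^3)^2 appear in [N2]. *)
have nr2 : 1 <= 4 * (n%:R ^+ 2 * r ^+ 6).
  have : 1 <= (n%:R * r ^+ 5) ^+ 2 by rewrite exprn_ege1.
  have -> : (n%:R * r ^+ 5) ^+ 2 = n%:R ^+ 2 * r ^+ 6 * (r ^+ 2 * r ^+ 2) by ring.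
  have : n%:R ^+ 2 * r ^+ 6 * (r ^+ 2 * r ^+ 2) <= n%:R ^+ 2 * r ^+ 6 * (2 * 2).
    by rewrite ler_wpM2l ?mulr_ge0 ?exprn_ge0 ?(ltW r0) // ler_pM ?sqr_ge0 ?(ltW r2).
  by move: (_ * (r ^+ 2 * r ^+ 2)) => A; clear; lra.
have N2 : N ^+ 2 <= 16 * D ^+ 2 * n%:R ^+ 2.
  have : N ^+ 2 * 1 <= N ^+ 2 * (4 * (n%:R ^+ 2 * r ^+ 6)) by rewrite ler_wpM2l ?sqr_ge0.
  have : (N * r ^+ 3) ^+ 2 * (4 * n%:R ^+ 2) <= (2 * D) ^+ 2 * (4 * n%:R ^+ 2).
    by rewrite ler_wpM2r ?mulr_ge0 ?sqr_ge0 // lerXn2r ?nnegrE ?mulr_ge0 ?exprn_ge0 ?(ltW r0) ?(ltW D0).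
  by clear; lra.
apply: (le_trans (ler_pM (sqr_ge0 N) _ N2 pow)).
  rewrite exprn_ge0 // subr_ge0 ler_pdivrMr ?mulr_gt0 // mul1r.
  by move: r5 D1; clear; lra.
by rewrite [n%:R ^+ 3]exprSr invfM mulrA mulfK // expf_neq0 // gt_eqF.
Qed.

(** * Probability that one cop wins *)

Section Probability.
Variables (R : realType) (d : measure_display) (T : measurableType d)
  (P : probability T R) (n : nat) (X Y : 'I_n -> T -> R) (r : R).
Hypotheses (iid : iid_uniform_square P X Y) (n0 : (0 < n)%N) (r0 : 0 < r).

Let win := [set w | cops_win (rgg_adj (X ^~ w) (Y ^~ w) r) 1].

Lemma measurable_cops_win : measurable win.
Proof. by case: iid => mX [mY _]; exact: (measurable_rgg_event r (fun a => cops_win a 1) mX mY). Qed.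

Lemma prob_cops_win_grid M :
  r ^+ 2 < 2 -> 10000 / M.+1%:R <= r ^+ 3 -> M.+1%:R * r ^+ 3 <= 2 * 10000 ->
  ((1 - M.+1%:R ^+ 2 * (1 - r ^+ 5 / (64 * 10000)) ^+ n)%:E <= P win)%E.
Proof.
move=> r2 rM1 rM2.
have [K1 _] := lens_size_bounds r0 r2 rM1.
pose far (c : 'I_M.+1 * 'I_M.+1) := r <= 4 * corner_norm R c.
pose bad := [set f : {ffun 'I_n -> 'I_M.+1 * 'I_M.+1} |
  [exists c, far c && [forall i, f i \notin lens r c]]]%SET.
have cbad : (#|bad| <= (M.+1 * M.+1) * (M.+1 * M.+1 - lens_size M r) ^ n)%N.
  have := @card_missing n _ far (@lens R M r) (lens_size M r).
  rewrite card_prod card_ord; apply => c fc.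
  by rewrite card_lens.
have cgood : (#|~: bad| = (M.+1 * M.+1) ^ n - #|bad|)%N.
  by rewrite cardsCs finset.setCK card_ffun card_prod !card_ord.
apply: le_trans (prob_ge_cells iid (good := (~: bad)%SET) measurable_cops_win _); last first.
  move=> f; rewrite inE /bad finset.inE => /existsPn fgood w wf.
  apply: (@cops_win_grid _ _ M _ _ _ (Ordinal n0) f) => //.
  - by move=> i; have [] := wf i I.
  - by move=> i; have [] := wf i I.
  move=> c fc; have := fgood c; rewrite /far fc /= => /forallPn[i]; rewrite negbK => h.
  by exists i.
rewrite lee_fin.
have N0 : 0 < M.+1%:R :> R by rewrite ltr0n.
move: (_ / (64 * 10000)) (lens_density r0 r2 rM1 rM2) => q qK.
(* With N = [M.+1] and K the lens size, at least N^(2n) - N^2 (N^2 - K)^n configurations are good;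
   dividing by N^(2n) gives 1 - N^2 (1 - K / N^2)^n. *)
have h1 : ((M.+1 * M.+1) ^ n)%:R - M.+1%:R ^+ 2 *
    (M.+1%:R ^+ 2 - (lens_size M r)%:R) ^+ n <= #|~: bad|%:R :> R.
  rewrite cgood; apply: (@le_trans _ _ (((M.+1 * M.+1) ^ n)%:R - #|bad|%:R)).
    rewrite lerD2l lerN2 expr2 -natrM -natrB // -natrX -natrM ler_nat.
    exact: cbad.
  by rewrite lerBlDr -natrD ler_nat addnC -leq_subLR.
apply: le_trans (ler_wpM2r _ h1); last by rewrite exprn_ge0 // invr_ge0 exprn_ge0 // ltW.
rewrite mulrBl natrX natrM -expr2 -exprMn mulfV ?expr1n; last by rewrite expf_neq0 ?gt_eqF.
rewrite lerD2l lerN2 -mulrA -exprMn ler_wpM2l ?sqr_ge0 //.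
rewrite mulrBl mulfV; last by rewrite expf_neq0 ?gt_eqF.
have K1' : (lens_size M r)%:R / M.+1%:R ^+ 2 <= 1 :> R.
  by rewrite ler_pdivrMr ?exprn_gt0 // mul1r expr2 -natrM ler_nat.
by apply: lerXn2r; rewrite ?nnegrE ?subr_ge0 ?lerD2l ?lerN2 ?(le_trans qK).
Qed.

(** The grid with a single cell ([M = 0]) has one configuration, of probability 1; it places all
    vertices in the unit square. *)
Lemma prob_cops_win_dense : 2 <= r ^+ 2 -> P win = 1%E.
Proof.
move=> r2; apply/eqP; rewrite eq_le.
apply/andP; split; first exact/probability_le1/measurable_cops_win.
have := @prob_ge_cells _ _ _ P _ _ _ 0 iid [set: {ffun 'I_n -> 'I_1 * 'I_1}]%SET win measurable_cops_win.
rewrite cardsT card_ffun card_prod !card_ord mul1n exp1n expr1n invr1 expr1n mulr1; apply.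
move=> f _ w wf; apply: (cops_win_clique (Ordinal n0)) => // i.
  by have [/in_cell01 + _] := wf i I; rewrite ler_norml; lra.
by have [_ /in_cell01] := wf i I; rewrite ler_norml; lra.
Qed.

Lemma prob_cops_win : (1 < n)%N -> 192 * 10000 * ln n%:R / n%:R < r ^+ 5 ->
  ((1 - 16 * 10000 ^+ 2 / n%:R)%:E <= P win)%E.
Proof.
move=> n1 rn; have n0' : 0 < n%:R :> R by rewrite ltr0n.
(* Below r = sqrt 2, r^3 <= 3 allows a mesh between r^3 / 20000 and r^3 / 10000. *)
have [r2|r2] := leP 2 (r ^+ 2).
  rewrite prob_cops_win_dense // lee_fin lerBlDr lerDl.
  by apply: divr_ge0; [apply: mulr_ge0; [lra|exact: sqr_ge0]|exact: ltW].
have r30 : 0 < r ^+ 3 by rewrite exprn_gt0.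
have [|M [rM1 rM2]] := @mesh_exists R (r ^+ 3) 10000.
  by rewrite r30; have := cube_le3 r0 r2; lra.
apply: le_trans (prob_cops_win_grid r2 rM1 rM2); rewrite lee_fin lerD2l lerN2.
have D1 : 1 <= 10000 :> R by lra.
exact: (failure_bound n1 r0 r2 D1 (ler0n R M.+1) rM2 rn).
Qed.

End Probability.

Lemma cvg_one_sub_inv (R : realType) (c : R) :
  (1 - c / n%:R)%:E @[n --> \oo] --> 1%E.
Proof.
apply: cvg_EFin; first by near=> n.
rewrite /= -[X in _ --> X]subr0 -[X in _ - X](mulr0 c).
apply: cvgB; first exact: cvg_cst.
apply: cvgM; first exact: cvg_cst.
(* The harmonic sequence is 1 / (n + 1), hence the shift. *)
by rewrite -(cvg_shiftS (fun n => n%:R^-1 : R)); exact: cvg_harmonic.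
Unshelve. all: by end_near.
Qed.

Theorem theorem2p1 (R : realType) :
  exists c2 : R, 0 < c2 /\
  forall r : nat -> R,
    (forall n, 0 < r n) ->
    (forall n, c2 * ln (n%:R) / n%:R < r n ^+ 5) ->
    forall (d : nat -> measure_display) (T : forall n, measurableType (d n))
           (P : forall n, probability (T n) R)
           (X Y : forall n, 'I_n -> T n -> R),
      (forall n, iid_uniform_square (P n) (X n) (Y n)) ->
      (P n [set w | cop_number_is (rgg_adj (X n ^~ w) (Y n ^~ w) (r n)) 1%N])%E
        @[n --> \oo] --> 1%E.
Proof.
(* Each lens has density at least r^5 / (64 * 10000), which this constant makes larger than 3 ln n /
   n. *)
exists (192 * 10000); split => [|r r0 rn d T P X Y iid]; first by lra.
have eventE n : [set w | cop_number_is (rgg_adj (X n ^~ w) (Y n ^~ w) (r n)) 1%N] =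
    [set w | cops_win (rgg_adj (X n ^~ w) (Y n ^~ w) (r n)) 1].
  apply/seteqP; split => w [] //=; first by move=> _ [].
  by move=> c hc; split=> //; split; [exists c | case].
under eq_fun do rewrite eventE.
apply: (@squeeze_cvge _ _ _ _ (fun n => (1 - 16 * 10000 ^+ 2 / n%:R)%:E) _ (fun=> 1%E)).
- near=> n.
  have n1 : (1 < n)%N by near: n; exact: nbhs_infty_gt.
  apply/andP; split; first exact: prob_cops_win (iid n) (ltnW n1) (r0 n) n1 (rn n).
  exact/probability_le1/measurable_cops_win/iid.
- exact: cvg_one_sub_inv.
- exact: cvg_cst.
Unshelve. all: by end_near.
Qed.
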